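(* Let $p,q$ be positive integers with $p<q$. Then there exists a (finite, simple, connected) bipartite graph $G$ such that $\mathrm{dep}(G)=p/q$.
   Context: For a connected graph $G$, $\tau(G)$ is the number of spanning trees of $G$, and for $e\in E(G)$, $\tau_G(e)$ is the number of spanning trees of $G$ containing $e$. The spanning tree edge density of $e$ is $d_G(e)=\tau_G(e)/\tau(G)$, and the spanning tree edge dependence of $G$ is $\mathrm{dep}(G)=\max_{e\in E(G)}d_G(e)$. *)

(* Defs.v *)
From mathcomp Require Import all_boot all_order all_algebra.

Set Implicit Arguments.
Unset Strict Implicit.
Unset Printing Implicit Defensive.

Import Order.TTheory GRing.Theory Num.Theory.
Local Open Scope ring_scope.

Record sgraph := SGraph {
  vertex :> finType;
  adj : rel vertex;
  adj_sym : symmetric adj;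
  adj_irrefl : irreflexive adj
}.

Section Relations.
Variables (T : finType) (r : rel T).

Definition rconnected : bool :=
  (0 < #|T|)%N && [forall x : T, forall y : T, connect r x y].

(* A cycle is a cyclic sequence of at least three distinct vertices. The length
   bound #|T| only makes the quantifier finite: see racyclicP. *)
Definition racyclic : bool :=
  [forall n : 'I_#|T|.+1, forall c : n.-tuple T, (2 < n)%N ==> ~~ ucycleb r c].

Lemma racyclicP :
  reflect (forall c : seq T, (2 < size c)%N -> ~ ucycle r c) racyclic.
Proof.
apply: (iffP forallP) => [H c c_gt2 c_cyc | H n].
  have c_le : (size c < #|T|.+1)%N.
    by rewrite ltnS -(card_uniqP (ucycle_uniq c_cyc)) max_card.
  have /forallP/(_ (in_tuple c)) := H (Ordinal c_le).
  by rewrite /= c_gt2 /= => /negP; apply.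
apply/forallP => c; apply/implyP => n_gt2; apply/negP.
by apply: H; rewrite size_tuple.
Qed.

Definition rtree : bool := rconnected && racyclic.

End Relations.

Section Graphs.
Variable G : sgraph.

Definition connected : Prop := rconnected (@adj G).

Definition bipartite : Prop :=
  exists A : {set G}, forall x y : G, adj x y -> (x \in A) != (y \in A).

Definition edges : {set {set G}} :=
  [set f : {set G} | [exists x : G, exists y : G, adj x y && (f == [set x; y])]].

(* Adjacency in the spanning subgraph (V(G), F). *)
Definition edge_rel (F : {set {set G}}) : rel G :=
  [rel x y | [set x; y] \in F].

(* Spanning trees are identified with their edge sets. *)
Definition spanning_trees : {set {set {set G}}} :=
  [set F : {set {set G}} | (F \subset edges) && rtree (edge_rel F)].

Definition tau : nat := #|spanning_trees|.

Definition tau_edge (f : {set G}) : nat :=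
  #|[set F in spanning_trees | f \in F]|.

Definition density (f : {set G}) : rat := (tau_edge f)%:R / (tau)%:R.

(* Densities are nonnegative, so the default value 0 only matters when G has
   no edges. *)
Definition dep : rat := \big[Num.max/0]_(f in edges) density f.

End Graphs.

(* Main.v *)
(* Densities are effective resistances. For an edge xy, let phi(v) count the
   spanning trees T containing xy such that v lies on the side of x in T - xy.
   Exchanging xy with another edge of the cut shows that the Laplacian of phi
   is tau(G)(delta_x - delta_y), so by self-adjointness any potential psi with
   Laplacian C(delta_x - delta_y) gives d(xy) = (psi(x) - psi(y)) / C, and the
   energy of phi is tau(G) tau(xy). The energy bounds the density of an edge of
   a biclique K_{a,b} by O((a + b)/(ab)), even inside a larger graph.

   The graph realizing p/q is a long chain of layers of alternating sizes N and
   M, consecutive layers being completely joined, plus one edge e between a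
   vertex of the first and a vertex of the last layer. If D is N + M plus the
   number of layers minus 3, then d(e) = D / (D + NM), which is made equal to
   p/q by the choice of the sizes and of the number of layers. For N and M large
   every other edge has density at most p/q. *)
Require Import Defs.
From mathcomp Require Import all_boot all_order all_algebra.
From mathcomp Require Import zify ring lra.

Set Implicit Arguments.
Unset Strict Implicit.
Unset Printing Implicit Defensive.

Import Order.TTheory GRing.Theory Num.Theory.
Local Open Scope ring_scope.

(** * Sums against point masses *)

Lemma sum_delta (I : finType) (j : I) (F : I -> rat) :
  \sum_i (i == j)%:R * F i = F j.
Proof.
rewrite (bigD1 j) //= eqxx mul1r big1 ?addr0 // => i /negPf ->.
exact: mul0r.
Qed.

Lemma sum_dipole (I : finType) (i j : I) (F : I -> rat) C :
  \sum_k F k * (C * ((k == i)%:R - (k == j)%:R)) = C * (F i - F j).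
Proof.
rewrite -(sum_delta i F) -(sum_delta j F) -sumrB mulr_sumr.
by apply: eq_bigr => k _; ring.
Qed.

Arguments edge_rel {G} F _ _ /.

(** * Connectivity by edge sets *)

Section EdgeSets.
Variable G : sgraph.
Implicit Types (F T : {set {set G}}) (x y u v w z : G).

Local Notation conn F := (connect (edge_rel F)).

Lemma mem_edges u v : ([set u; v] \in edges G) = adj u v.
Proof.
rewrite inE; apply/existsP/idP => [[a /existsP[b /andP[ab /eqP e]]]|uv]; last first.
  by exists u; apply/existsP; exists v; rewrite uv eqxx.
have ua : u \in [set a; b] by rewrite -e set21.
have va : v \in [set a; b] by rewrite -e set22.
have au : a \in [set u; v] by rewrite e set21.
have bu : b \in [set u; v] by rewrite e set22.
have nab : a != b by apply: contraTneq ab => ->; rewrite adj_irrefl.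
move: ua va au bu; rewrite !inE.
case/orP=> /eqP ->; case/orP=> /eqP -> //.
- by move=> _; rewrite orbb eq_sym (negPf nab).
- by rewrite adj_sym.
- by rewrite orbb (negPf nab).
Qed.

Lemma edge_rel_sym F : symmetric (edge_rel F).
Proof. by move=> u v; rewrite /edge_rel /= setUC. Qed.

Lemma conn_sym F u v : conn F u v = conn F v u.
Proof. exact/sym_connect_sym/edge_rel_sym. Qed.

Lemma sub_conn F T u v : F \subset T -> conn F u v -> conn T u v.
Proof.
move=> /subsetP sFT; apply: connect_sub => a b /= ab.
by apply: connect1; apply: sFT.
Qed.

(** A walk can be shortened until it crosses the new edge at most once, in one of two directions. *)
Lemma conn_setU1 F w z u v : conn ([set w; z] |: F) u v =
  [|| conn F u v, conn F u w && conn F z v | conn F u z && conn F w v].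
Proof.
have FT : F \subset [set w; z] |: F by apply: subsetUr.
have wz : conn ([set w; z] |: F) w z by apply: connect1; rewrite /= setU11.
apply/idP/or3P; last first.
  case=> [|/andP[uw zv]|/andP[uz wv]]; first exact: sub_conn.
  - apply: connect_trans (sub_conn FT uw) _.
    exact: connect_trans wz (sub_conn FT zv).
  - apply: connect_trans (sub_conn FT uz) _.
    by rewrite conn_sym in wz; apply: connect_trans wz (sub_conn FT wv).
case/connectP => p; elim: p u => [|a p IHp] u /=.
  by move=> _ ->; constructor 1.
rewrite in_setU1 => /andP[/orP[/eqP ua|ua] pa] lv; last first.
  have ca : conn F u a by apply: connect1.
  case: (IHp _ pa lv) => [av|/andP[aw zv]|/andP[az wv]].
  - by constructor 1; apply: connect_trans av.
  - by constructor 2; rewrite zv (connect_trans ca aw).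
  - by constructor 3; rewrite wv (connect_trans ca az).
have uwz : u \in [set w; z] by rewrite -ua set21.
have awz : a \in [set w; z] by rewrite -ua set22.
move: uwz awz; rewrite !inE.
case: (IHp _ pa lv) => [av|/andP[aw zv]|/andP[az wv]].
- case/orP=> /eqP eu; case/orP=> /eqP ea; rewrite ea in av; subst u.
  + by constructor 1.
  + by constructor 2; rewrite connect0.
  + by constructor 3; rewrite connect0.
  + by constructor 1.
- case/orP=> /eqP ? ; subst u; first by constructor 2; rewrite connect0.
  by move=> _; constructor 1.
- case/orP=> /eqP ? ; subst u; first by constructor 1.
  by move=> _; constructor 3; rewrite connect0.
Qed.

(** * Acyclicity, spanning trees and two-component forests *)

Definition bridged F : bool :=
  [forall u, forall v,
    ([set u; v] \in F) ==> ~~ conn (F :\ [set u; v]) u v].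

Lemma bridgedP F : reflect
  (forall u v, [set u; v] \in F -> ~~ conn (F :\ [set u; v]) u v) (bridged F).
Proof.
apply: (iffP forallP) => [H u v|H u]; first by have /forallP/(_ v)/implyP := H u.
by apply/forallP => v; apply/implyP/H.
Qed.

Lemma path_setD1 F u v s p : path (edge_rel F) s p ->
  u \notin s :: p -> path (edge_rel (F :\ [set u; v])) s p.
Proof.
elim: p s => //= a p IHp s /andP[sa pa]; rewrite !inE !negb_or.
case/and3P => us ua up; rewrite sa andbT IHp ?inE ?negb_or ?ua //.
rewrite andbT; apply/eqP => e.
by have := set21 u v; rewrite -e !inE (negPf us) (negPf ua).
Qed.

(** An edge closes a cycle exactly when its ends stay joined without it. Bridges state acyclicity
    through connectivity alone, which [conn_setU1] can update. *)
Lemma racyclicE F : F \subset edges G -> racyclic (edge_rel F) = bridged F.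
Proof.
move=> FE; apply/racyclicP/bridgedP => [acyc u v uv|br c c_gt2].
  apply/negP => /connectP[p0 p0P lv]; move: lv.
  case/shortenP: p0P => p pP up _ lv.
  apply: (acyc (u :: p)).
    have : adj u v by rewrite -mem_edges (subsetP FE).
    case: p lv pP up => [|a [|b p]] //= ->; first by rewrite adj_irrefl.
    by rewrite !inE eqxx.
  rewrite /ucycle up andbT (cycle_path u) /= -lv /= setUC uv /=.
  by apply: sub_path pP => a b /=; rewrite inE => /andP[].
case: c c_gt2 => [|x [|y [|z c]]] // _ /andP[].
rewrite /cycle rcons_cons [path _ _ _]/= => /andP[xy]; set s := z :: c => yx.
rewrite cons_uniq => /andP[xys us].
have := br _ _ xy; rewrite conn_sym => /negP; apply.
have {yx} : path (edge_rel F) y (rcons s x) by [].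
rewrite rcons_path => /andP[ys lx].
(* The rest of the cycle avoids [x] until its last edge, which differs from [[set x; y]] because [y]
   is not repeated. *)
apply: (@connect_trans _ _ (last y s)).
  by apply/connectP; exists s => //; apply: path_setD1.
apply: connect1; rewrite /= in lx *; rewrite in_setD1 lx andbT.
apply/eqP => e; have : y \in [set last z c; x] by rewrite e set22.
rewrite !inE => /orP[/eqP yl|/eqP yxe].
  by move: us; rewrite /= yl (mem_last z c).
by move: xys; rewrite yxe mem_head.
Qed.

(** Spanning forests with two components, one holding [w] and the other [z]. Such a forest is not
    tied to a deleted edge, so the same [F] can be read against several edges of its cut. *)
Definition bridged_split F w z : bool :=
  [&& F \subset edges G, bridged F, ~~ conn F w z
    & [forall v, conn F w v || conn F z v]].

Lemma spanning_treeP T : reflect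
  [/\ T \subset edges G, bridged T, (0 < #|G|)%N & forall u v, conn T u v]
  (T \in spanning_trees G).
Proof.
rewrite inE /rtree /rconnected.
apply: (iffP and3P) => [[TE /andP[G0 /forallP cT] ac]|[TE bT G0 cT]].
  by split=> // [|u v]; [rewrite -racyclicE | apply: (forallP (cT u))].
split=> //; last by rewrite racyclicE.
by rewrite G0; apply/forallP => u; apply/forallP.
Qed.

(** The new edge joins the two components. An old edge [uv] stays a bridge: a detour from [u] to [v]
    through [wz], combined with [uv], would join [w] to [z] inside [F]. *)
Lemma tree_splitE F w z : adj w z ->
  ([set w; z] \notin F) && ([set w; z] |: F \in spanning_trees G)
  = bridged_split F w z.
Proof.
move=> wz; set g := [set w; z]; apply/andP/and4P.
  case=> gF /spanning_treeP[TE /bridgedP br _ cT].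
  have sF := subsetUr [set g] F.
  have gTF : (g |: F) :\ g = F by rewrite setU1K.
  have nwz : ~~ conn F w z by have := br w z (setU11 _ _); rewrite gTF.
  split=> //; first exact: subset_trans sF TE.
    apply/bridgedP => u v uv.
    apply: contra (br u v (setU1r g uv)); apply: sub_conn.
    exact: setSD.
  apply/forallP => v; have := cT w v.
  rewrite conn_setU1 connect0 (negPf nwz) /= orbF.
  by [].
case=> FE /bridgedP br nwz /forallP span.
have gF : g \notin F by apply: contra nwz => gF; apply: connect1.
split=> //; apply/spanning_treeP; split.
- by rewrite subUset FE andbT sub1set mem_edges.
- apply/bridgedP => u v; rewrite in_setU1 => /orP[/eqP e|uv].
    rewrite e setU1K //.
    have : u \in g by rewrite -e set21.
    have : v \in g by rewrite -e set22.
    have nuv : u != v.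
      apply: contraTneq wz => uv; rewrite -mem_edges -/g -e mem_edges uv.
      by rewrite adj_irrefl.
    rewrite !inE; case/orP=> /eqP ev; case/orP=> /eqP eu;
      subst u v; rewrite ?eqxx // in nuv *.
    by rewrite conn_sym.
  have -> : (g |: F) :\ [set u; v] = g |: (F :\ [set u; v]).
    apply/setP => h; rewrite !inE; case: (h =P g) => //= ->.
    by rewrite andbT; apply: contraNneq gF => ->.
  have sF : F :\ [set u; v] \subset F by apply: subsetDl.
  have cuv : conn F u v by apply: connect1.
  rewrite conn_setU1 (negPf (br _ _ uv)) /=.
  apply: contra nwz => /orP[/andP[a b]|/andP[a b]].
    move: (sub_conn sF a) (sub_conn sF b); rewrite conn_sym => wu zv.
    apply: connect_trans wu (connect_trans cuv _); by rewrite conn_sym.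
  move: (sub_conn sF a) (sub_conn sF b) => uz wv.
  apply: connect_trans wv (connect_trans _ uz); by rewrite conn_sym.
- by apply/card_gt0P; exists w.
- have cwv v : conn (g |: F) w v.
    rewrite conn_setU1 connect0 /=; have /orP[->//|->] := span v.
    by rewrite orbT.
  by move=> u v; apply: (@connect_trans _ _ w); rewrite // conn_sym.
Qed.

(* Only the components of [w] and [z] enter in [bridged_split F w z]. *)
Lemma bridged_split_conn F x y w z : conn F x w -> conn F y z ->
  bridged_split F x y = bridged_split F w z.
Proof.
move=> xw yz; rewrite /bridged_split.
have cE a b v : conn F a b -> conn F a v = conn F b v.
  by move=> ab; apply: (same_connect (@conn_sym F)).
rewrite (cE _ _ _ xw) [conn F w y]conn_sym (cE _ _ _ yz) [conn F z w]conn_sym.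
by congr [&& _, _, _ & _]; apply: eq_forallb => v; rewrite (cE _ _ _ xw) (cE _ _ _ yz).
Qed.

Lemma bridged_splitC F x y : bridged_split F x y = bridged_split F y x.
Proof.
rewrite /bridged_split conn_sym; congr [&& _, _, _ & _].
by apply: eq_forallb => v; rewrite orbC.
Qed.

Lemma bridged_split_compl F x y v : bridged_split F x y ->
  conn F y v = ~~ conn F x v.
Proof.
case/and4P=> _ _ nxy /forallP/(_ v); case xv: (conn F x v) => //= _.
apply: contraNF nxy => yv; apply: connect_trans xv _.
by rewrite conn_sym.
Qed.

(** * The tree-counting potential and its Laplacian *)

Lemma sum_split_tree w z (f : {set {set G}} -> rat) : adj w z ->
  \sum_(F | bridged_split F w z) f F =
  \sum_(T in spanning_trees G | [set w; z] \in T) f (T :\ [set w; z]).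
Proof.
move=> wz; set g := [set w; z].
rewrite [RHS](reindex_onto (fun F => g |: F) (fun T => T :\ g)) /=; last first.
  by move=> T /andP[_ gT]; apply: setD1K.
apply: eq_big => [F|F FS].
  rewrite -tree_splitE // -/g setU11 andbT andbC; congr (_ && _).
  apply/idP/eqP => [gF|<-]; [exact: setU1K | by rewrite setD11].
have: g \notin F by move: FS; rewrite -tree_splitE // => /andP[].
by move=> gF; rewrite setU1K.
Qed.

(** For adjacent [x] and [y] this is the function phi: a tree through [xy] is recorded as the forest
    left by deleting [xy]. *)
Definition flow_pot x y v : rat :=
  \sum_(F | bridged_split F x y) (conn F x v)%:R.

Definition lap (f : G -> rat) w : rat := \sum_z (adj w z)%:R * (f w - f z).

(* The tree path from [w] to [x] leaves [w] by exactly one edge. *)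
Lemma tree_towards T w x : T \in spanning_trees G ->
  \sum_z ([set w; z] \in T)%:R * (~~ conn (T :\ [set w; z]) w x)%:R
  = (w != x)%:R :> rat.
Proof.
case/spanning_treeP => TE /bridgedP br _ cT.
case: eqP => [->|/eqP nwx] /=.
  by rewrite big1 // => z _; rewrite connect0 mulr0.
have [z wz zx] : exists2 z, [set w; z] \in T & conn (T :\ [set w; z]) z x.
  have /connectP[p0 p0P lx] := cT w x; move: lx.
  case/shortenP: p0P => -[|z p] /=; first by move=> _ _ _ e; rewrite e eqxx in nwx.
  case/andP=> wz zp /andP[wnp _] _ lx; exists z => //.
  by apply/connectP; exists p => //; apply: path_setD1.
have nw a b : [set w; a] \in T -> conn (T :\ [set w; a]) a b ->
    ~~ conn (T :\ [set w; a]) w b.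
  move=> wa ab; apply: contra (br _ _ wa) => wb.
  by apply: connect_trans wb _; rewrite conn_sym.
rewrite (bigD1 z) //= wz (nw _ _ wz zx) mulr1 big1 ?addr0 // => z' zz'.
case wz': ([set w; z'] \in T); last by rewrite mul0r.
rewrite mul1r; case wx: (conn _ w x) => //=; exfalso.
(* If a second edge [wz'] also led to [x], then [z'] would reach [x] avoiding both edges, so [w]
   would reach [x] through [z'] without [wz]. *)
have eqe : [set w; z] != [set w; z'].
  apply: contraNneq zz' => e; have : z' \in [set w; z] by rewrite e set22.
  rewrite !inE => /orP[/eqP z'w|->] //.
  move: wz'; rewrite z'w => /(subsetP TE).
  by rewrite mem_edges adj_irrefl.
set g := [set w; z] in wz zx eqe; set g' := [set w; z'] in wz' wx eqe.
have z'x : conn (T :\ g') z' x.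
  move: (cT z' x); rewrite -{1}(setD1K wz') conn_setU1 wx andbF orbF.
  by case/orP => // /andP[].
have gT : g \in T :\ g' by rewrite in_setD1 eqe wz.
have z'xg : conn (T :\ g) z' x.
  move: z'x; rewrite -{1}(setD1K gT) conn_setU1.
  have sD : T :\ g' :\ g \subset T :\ g by apply: setSD; apply: subsetDl.
  case/or3P => [|/andP[z'w _]|/andP[_ w_x]]; first exact: sub_conn.
    have := br _ _ wz'; rewrite conn_sym => /negP[].
    exact: sub_conn (subsetDl _ _) z'w.
  by rewrite (sub_conn (subsetDl _ _) w_x) in wx.
have := nw _ _ wz zx => /negP; apply.
by apply: connect_trans (connect1 _) z'xg; rewrite /= in_setD1 eq_sym eqe.
Qed.

(** The edge exchange. If [F] separates both pairs, both sides are 1 or both are -1, according to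
    whether [w] lies with [x] or with [y]; otherwise both vanish. *)
Lemma bridged_split_swap F x y w z :
  (if bridged_split F x y then (conn F x w)%:R - (conn F x z)%:R else 0) =
  (if bridged_split F w z then (conn F w x)%:R - (conn F w y)%:R else 0) :> rat.
Proof.
have aux a b c d : bridged_split F a b -> conn F a c -> ~~ conn F a d ->
    bridged_split F c d.
  by move=> S ac ad; rewrite -(bridged_split_conn ac _ (y := b)) // (bridged_split_compl d S).
case: ifP => [S|/negP nS]; case: ifP => [S'|/negP nS'].
- have := bridged_split_compl z S; have := bridged_split_compl x S'.
  have := bridged_split_compl y S'; have := bridged_split_compl w S.
  rewrite ![conn F _ x]conn_sym ![conn F _ y]conn_sym.
  by case: (conn F x w) (conn F x z) (conn F y w) (conn F y z)
    => [] [] [] [] //= _ _ _ _; lra.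
- case xw: (conn F x w); case xz: (conn F x z); rewrite /= ?subrr //; case: nS'.
    by apply: (aux _ _ _ _ S xw); rewrite xz.
  by rewrite bridged_splitC; apply: (aux _ _ _ _ S xz); rewrite xw.
- case wx: (conn F w x); case wy: (conn F w y); rewrite /= ?subrr //; case: nS.
    by apply: (aux _ _ _ _ S' wx); rewrite wy.
  by rewrite bridged_splitC; apply: (aux _ _ _ _ S' wy); rewrite wx.
- by [].
Qed.

(** After the exchange, the neighbour [z] contributes a sum over the trees through [wz]. Regrouped
    by tree, [tree_towards] leaves one edge at [w] towards [y] minus one towards [x], absent when
    [w] is that vertex. *)
Lemma lap_flow_pot x y w : adj x y ->
  lap (flow_pot x y) w = (tau G)%:R * ((w == x)%:R - (w == y)%:R).
Proof.
move=> xy; rewrite /lap.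
pose c F a b : rat := (conn F a b)%:R.
have -> : \sum_z (adj w z)%:R * (flow_pot x y w - flow_pot x y z) =
    \sum_z \sum_(F | adj w z && bridged_split F w z) (c F w x - c F w y).
  apply: eq_bigr => z _; case wz: (adj w z) => /=; last first.
    by rewrite mul0r big_pred0.
  rewrite mul1r /flow_pot -sumrB big_mkcond [RHS]big_mkcond /=.
  by apply: eq_bigr => F _; apply: bridged_split_swap.
transitivity (\sum_z \sum_(T in spanning_trees G | [set w; z] \in T)
    (c (T :\ [set w; z]) w x - c (T :\ [set w; z]) w y)).
  apply: eq_bigr => z _; case wz: (adj w z) => /=; first exact: sum_split_tree.
  rewrite !big_pred0 // => T; apply/negbTE/negP => /andP[].
  by case/spanning_treeP=> TE _ _ _ /(subsetP TE); rewrite mem_edges wz.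
rewrite (exchange_big_dep (mem (spanning_trees G))) /=; last first.
  by move=> ? ? _ /andP[].
transitivity (\sum_(T in spanning_trees G) ((w == x)%:R - (w == y)%:R : rat)); last first.
  by rewrite sumr_const /tau mulr_natl.
apply: eq_bigr => T TS.
have -> : (w == x)%:R - (w == y)%:R = (w != y)%:R - (w != x)%:R :> rat.
  by do 2 case: eqP => _ /=; lra.
rewrite -(tree_towards w x TS) -(tree_towards w y TS) -sumrB big_mkcond /=; apply: eq_bigr => z _.
rewrite TS /c; case: (_ \in T) => /=; last by rewrite !mul0r subr0.
by do 2 case: (conn _ _ _) => /=; lra.
Qed.


(** Summation by parts: the sum is averaged with its copy where [w] and [z] are exchanged. The
    result is symmetric in [f] and [g], and for [f = g] it is the Dirichlet energy. *)
Lemma lap_sym (f g : G -> rat) :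
  \sum_w f w * lap g w =
  2^-1 * \sum_w \sum_z (adj w z)%:R * ((f w - f z) * (g w - g z)).
Proof.
set S := RHS; pose A := \sum_w f w * lap g w; rewrite -/A.
have A1 : A = \sum_w \sum_z (adj w z)%:R * (f w * (g w - g z)).
  by apply: eq_bigr => w _; rewrite mulr_sumr; apply: eq_bigr => z _; ring.
have A2 : A = \sum_w \sum_z (adj w z)%:R * (- f z * (g w - g z)).
  rewrite A1 exchange_big /=; apply: eq_bigr => w _; apply: eq_bigr => z _.
  by rewrite adj_sym; ring.
suff : 2 * S = A + A by lra.
rewrite /S mulrA divff // mul1r {1}A1 A2 -big_split; apply: eq_bigr => w _ /=.
by rewrite -big_split; apply: eq_bigr => z _ /=; ring.
Qed.

(** * Densities as effective resistances, and the energy bound *)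

Lemma tau_edgeE x y : adj x y -> (tau_edge [set x; y])%:R = flow_pot x y x.
Proof.
move=> xy; rewrite /flow_pot sum_split_tree //.
under eq_bigr do rewrite connect0.
rewrite sumr_const /tau_edge; congr _%:R; apply: eq_card => T.
by rewrite [LHS]inE.
Qed.

Lemma flow_pot0 x y : flow_pot x y y = 0.
Proof. by apply: big1 => F /and4P[_ _ /negPf -> _]. Qed.

(* Kirchhoff: the density is the effective resistance. *)
Lemma tau_edge_potential x y (psi : G -> rat) C : adj x y ->
  (forall w, lap psi w = C * ((w == x)%:R - (w == y)%:R)) ->
  (tau G)%:R * (psi x - psi y) = C * (tau_edge [set x; y])%:R.
Proof.
move=> xy lpsi; rewrite tau_edgeE // -[flow_pot _ _ _]subr0 -(flow_pot0 x y).
transitivity (\sum_w psi w * lap (flow_pot x y) w).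
  by under [RHS]eq_bigr do rewrite lap_flow_pot //; rewrite sum_dipole.
transitivity (\sum_w flow_pot x y w * lap psi w); last first.
  by under eq_bigr do rewrite lpsi; rewrite sum_dipole.
rewrite !lap_sym; congr (_ * _).
by apply: eq_bigr => w _; apply: eq_bigr => z _; ring.
Qed.

(** The factor 2 appears because each edge is summed in both directions. *)
Lemma tau_edge_energy x y : adj x y ->
  \sum_w \sum_z (adj w z)%:R * (flow_pot x y w - flow_pot x y z) ^+ 2
  = 2 * (tau G)%:R * (tau_edge [set x; y])%:R.
Proof.
move=> xy; have := lap_sym (flow_pot x y) (flow_pot x y).
under eq_bigr do rewrite lap_flow_pot //.
rewrite sum_dipole flow_pot0 subr0 tau_edgeE // => e.
rewrite -mulrA e mulrA divff // mul1r.
by apply: eq_bigr => w _; apply: eq_bigr => z _; rewrite expr2.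
Qed.

(* The mean over [u \in A], [v \in B] of the energy on the paths z-v-u-w. *)
Lemma tau_edge_biclique (A B : {set G}) z w : z \in A -> w \in B ->
  (forall u v, u \in A -> v \in B -> adj u v) ->
  (#|A| * #|B| * tau_edge [set z; w] <= 6 * (#|A| + #|B| + 1) * tau G)%N.
Proof.
move=> zA wB AB; have zw := AB _ _ zA wB; have := tau_edge_energy zw.
have := tau_edgeE zw; have := flow_pot0 z w.
set f := flow_pot z w => fw fz; set E := \sum_w _ => eE.
set D : rat := (tau_edge _)%:R in fz eE.
pose a : rat := #|A|%:R; pose b : rat := #|B|%:R.
have pos I (r : seq I) P (F : I -> rat) : 0 <= \sum_(i <- r | P i) F i ^+ 2.
  by apply: sumr_ge0 => i _; apply: sqr_ge0.
pose S := \sum_(u in A) \sum_(v in B) (f v - f u) ^+ 2.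
have SE : S <= E.
  rewrite /S big_mkcond; apply: ler_sum => u _; case: ifP => uA; last first.
    by apply: sumr_ge0 => v _; rewrite mulr_ge0 ?sqr_ge0.
  rewrite big_mkcond; apply: ler_sum => v _; case: ifP => vB; last first.
    by rewrite mulr_ge0 ?sqr_ge0.
  by rewrite AB // mul1r -sqrrN opprB.
(* The first and last legs of the paths z-v-u-w are the terms of [S] with [u = z] and with
   [v = w]. *)
have S1 : \sum_(v in B) (f z - f v) ^+ 2 <= S.
  rewrite [leRHS](bigD1 z) //= -[leLHS]addr0 lerD //.
    by apply: ler_sum => v _; rewrite -sqrrN opprB.
  by apply: sumr_ge0 => u _; apply: pos.
have S2 : \sum_(u in A) (f u - f w) ^+ 2 <= S.
  apply: ler_sum => u _; rewrite (bigD1 w) //= -[leLHS]addr0 lerD //.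
  by rewrite -sqrrN opprB.
have key : a * b * D ^+ 2 <= 3 * (a + b + 1) * E.
  have -> : a * b * D ^+ 2 = \sum_(u in A) \sum_(v in B) D ^+ 2.
    by rewrite !sumr_const -[_ *+ #|B|]mulr_natl -[_ *+ #|A|]mulr_natl mulrA.
  apply: (@le_trans _ _ (\sum_(u in A) \sum_(v in B)
    3 * ((f z - f v) ^+ 2 + (f v - f u) ^+ 2 + (f u - f w) ^+ 2))).
    apply: ler_sum => u _; apply: ler_sum => v _.
    have -> : D = (f z - f v) + (f v - f u) + (f u - f w).
      by rewrite fz fw; ring.
    set p := f z - f v; set q := f v - f u; set r := f u - f w.
    (* These squares add up to [3 * (p ^+ 2 + q ^+ 2 + r ^+ 2) - (p + q + r) ^+ 2]. *)
    have := sqr_ge0 (p - q); have := sqr_ge0 (q - r); have := sqr_ge0 (p - r).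
    nra.
  have -> : \sum_(u in A) \sum_(v in B)
      3 * ((f z - f v) ^+ 2 + (f v - f u) ^+ 2 + (f u - f w) ^+ 2) =
      3 * (a * (\sum_(v in B) (f z - f v) ^+ 2) + S
           + b * \sum_(u in A) (f u - f w) ^+ 2).
    under eq_bigr do rewrite -mulr_sumr !big_split /= sumr_const -[_ *+ #|B|]mulr_natl.
    rewrite -mulr_sumr !big_split /= sumr_const -[_ *+ #|A|]mulr_natl.
    by rewrite -mulr_sumr.
  have a0 : 0 <= a by apply: ler0n.
  have b0 : 0 <= b by apply: ler0n.
  nra.
rewrite -(ler_nat rat) !natrM !natrD -/a -/b -/D.
(* Since [E] is [2 * tau G * D], one factor [D] cancels in [key] unless [D] is 0. *)
have D0 : 0 <= D by apply: ler0n.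
move: D0; rewrite le_eqVlt => /orP[/eqP <-|D0].
  by rewrite mulr0 !mulr_ge0 ?addr_ge0 ?ler0n.
rewrite -(ler_pM2r D0) -[leLHS]mulrA -expr2; apply: le_trans key _.
by rewrite eE le_eqVlt; apply/orP; left; apply/eqP; ring.
Qed.

(** A minimal connected spanning edge set is a tree: an edge whose ends stay joined without it could
    be dropped. *)
Lemma tau_gt0 : connected G -> (0 < tau G)%N.
Proof.
case/andP=> G0 /forallP cG.
pose P F := (F \subset edges G) && [forall u, forall v, conn F u v].
have PE : P (edges G).
  rewrite /P subxx; apply/forallP => u; apply/forallP => v.
  have := forallP (cG u) v; apply: connect_sub => a b ab.
  by apply: connect1; rewrite /= mem_edges.
case: (minset_exists PE) => F /minsetP[/andP[FE /forallP cF] minF] _.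
apply/card_gt0P; exists F; apply/spanning_treeP; split=> //; last first.
  by move=> u v; apply: (forallP (cF u)).
apply/bridgedP => u v uv; apply/negP => cuv.
have /minF/(_ (subsetDl _ _)) e : P (F :\ [set u; v]).
  rewrite /P (subset_trans (subsetDl _ _) FE); apply/forallP => a; apply/forallP => b.
  have := forallP (cF a) b; rewrite -{1}(setD1K uv) conn_setU1.
  case/or3P => // /andP[x1 x2]; apply: connect_trans x1 (connect_trans _ x2) => //.
  by rewrite conn_sym.
by have := setD11 [set u; v] F; rewrite e uv.
Qed.

End EdgeSets.

(** * The layered graph *)

(* Complete bipartite graphs between consecutive layers: layer [2i] consists of
   the [inl (i, a)], layer [2i+1] of the [inr (i, b)]. One further edge joins
   a vertex of the first layer to a vertex of the last one. *)
Section LayeredGraph.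
Variables m n k : nat.

Definition layer_vertex : finType := ('I_m.+1 * 'I_n.+1 + 'I_m.+1 * 'I_k.+1)%type.

Definition layer_end : layer_vertex * layer_vertex :=
  (inl (ord0, ord0), inr (ord_max, ord0)).

(** Layers 2i and 2j+1 are consecutive in exactly these two cases. *)
Definition layer_link (i j : 'I_m.+1) : bool := (i == j) || (i == j.+1 :> nat).

Definition layer_adj : rel layer_vertex := fun u v =>
  match u, v with
  | inl p, inr r | inr r, inl p =>
      layer_link p.1 r.1 || ((inl p, inr r) == layer_end)
  | _, _ => false
  end.

Lemma layer_adj_sym : symmetric layer_adj.
Proof. by case=> ? [] ?. Qed.

Lemma layer_adj_irrefl : irreflexive layer_adj.
Proof. by case. Qed.

Definition layered : sgraph := SGraph layer_adj_sym layer_adj_irrefl.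

Lemma layered_bipartite : bipartite layered.
Proof.
exists [set u : layered | if u is inl _ then true else false].
by case=> ? [] ? //; rewrite !inE.
Qed.

Lemma layered_connected : connected layered.
Proof.
rewrite /connected /rconnected; apply/andP; split.
  by apply/card_gt0P; exists (layer_end.1 : layered).
have csym : connect_sym (@adj layered) by apply/sym_connect_sym/adj_sym.
have c0 i : (i <= m)%N -> forall a : 'I_n.+1,
    connect (@adj layered) (inl (ord0, ord0)) (inl (inord i, a)).
  elim: i => [_ a|i IHi im a].
    apply: (@connect_trans _ _ (inr (ord0, ord0) : layered)).
      exact: connect1.
    by apply: connect1; rewrite /= /layer_link -val_eqE /= inordK.
  apply: connect_trans (IHi (ltnW im) ord0) _.
  apply: (@connect_trans _ _ (inr (inord i, ord0) : layered)).
    by apply: connect1; rewrite /= /layer_link eqxx.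
  by apply: connect1; rewrite /= /layer_link !inordK ?eqxx ?orbT // ltnS ltnW.
have c1 u : connect (@adj layered) (inl (ord0, ord0)) u.
  case: u => -[i a]; first by have := c0 i (ltn_ord i) a; rewrite inord_val.
  have := c0 i (ltn_ord i) ord0; rewrite inord_val => /connect_trans; apply.
  by apply: connect1; rewrite /= /layer_link eqxx.
apply/forallP => u; apply/forallP => v.
by apply: connect_trans (c1 v); rewrite csym.
Qed.

(* Up to corrections with the correct mean on the first and last layers, the
   potential is minus the layer number. *)
Definition layer_pot (u : layered) : rat :=
  match u with
  | inl p => - (2 * p.1%:R) + (p.1 == ord0)%:R * (n.+1%:R * (p.2 == ord0)%:R - 1)
  | inr r => - (2 * r.1%:R + 1) + (r.1 == ord_max)%:R * (1 - k.+1%:R * (r.2 == ord0)%:R)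
  end.

(** * The Laplacian of the layer potential *)

Hypothesis m_gt0 : (0 < m)%N.

(** As [0 < m], the extra edge is not a link, so the three cases exclude one another and their
    indicators add. *)
Lemma layer_adjE p r : (layer_adj (inl p) (inr r))%:R =
  (p.1 == r.1)%:R + (p.1 == r.1.+1 :> nat)%:R
  + ((inl p, inr r) == layer_end)%:R :> rat.
Proof.
rewrite /layer_adj /layer_link; case: p r => i a [j b] /=.
rewrite /layer_end xpair_eqE -!val_eqE /=.
case: (i =P j :> nat) => [ij|_] /=.
  rewrite ij (ltn_eqF (ltnSn j)) /=; case: eqP => [[e _]|_]; last by rewrite !addr0.
  have -> : (inr (j, b) == inr (ord_max, ord0) :> layer_vertex) = false.
    by apply/eqP => -[jm _]; move: m_gt0; rewrite -[m]/(val (@ord_max m)) -jm /= -ij e.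
  by rewrite !addr0.
case: (i =P j.+1 :> nat) => [ij|_] /=; last by rewrite !add0r.
case: eqP => [[e _]|_] /=; last by rewrite add0r addr0.
by rewrite e in ij.
Qed.

(** The correction on the first layer sums to zero, so neighbouring layers do not feel it. *)
Lemma sum_layer_pot_l (c : rat) (i : 'I_m.+1) :
  \sum_(a < n.+1) (c - layer_pot (inl (i, a))) = n.+1%:R * (c + 2 * i%:R).
Proof.
rewrite (eq_bigr (fun a => (c + 2 * i%:R + (i == ord0)%:R)
    - (a == ord0)%:R * ((i == ord0)%:R * n.+1%:R))) => [|a _] /=; last by ring.
by rewrite sumrB sum_delta sumr_const card_ord -mulr_natl; ring.
Qed.

Lemma sum_layer_pot_r (c : rat) (j : 'I_m.+1) :
  \sum_(b < k.+1) (c - layer_pot (inr (j, b))) = k.+1%:R * (c + 2 * j%:R + 1).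
Proof.
rewrite (eq_bigr (fun b => (c + 2 * j%:R + 1 - (j == ord_max)%:R)
    + (b == ord0)%:R * ((j == ord_max)%:R * k.+1%:R))) => [|b _] /=; last by ring.
by rewrite big_split /= sum_delta sumr_const card_ord -mulr_natl; ring.
Qed.

Lemma sum_layer_adj_l i a (F : _ -> rat) :
  \sum_r (layer_adj (inl (i, a)) (inr r))%:R * F r =
  \sum_b F (i, b) + \sum_(j < m.+1) (i == j.+1 :> nat)%:R * (\sum_b F (j, b))
  + ((i, a) == (ord0, ord0))%:R * F (ord_max, ord0).
Proof.
rewrite (eq_bigr (fun r => (r.1 == i)%:R * F (r.1, r.2)
    + (i == r.1.+1 :> nat)%:R * F (r.1, r.2)
    + (r == (ord_max, ord0))%:R * (((i, a) == (ord0, ord0))%:R * F r))); last first.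
  case=> j b _; rewrite layer_adjE /= [i == j]eq_sym !mulrDl.
  rewrite /layer_end xpair_eqE andbC -mulnb natrM -mulrA; by congr (_ + _ * (_ * _)).
rewrite !big_split /= sum_delta; congr (_ + _ + _).
  rewrite -(pair_bigA _ (fun j b => (j == i)%:R * F (j, b))) /=.
  by under eq_bigr do rewrite -mulr_sumr; rewrite sum_delta.
rewrite -(pair_bigA _ (fun (j : 'I_m.+1) b => (i == j.+1 :> nat)%:R * F (j, b))) /=.
by apply: eq_bigr => j _; rewrite -mulr_sumr.
Qed.

Lemma sum_layer_adj_r j b (F : _ -> rat) :
  \sum_p (layer_adj (inr (j, b)) (inl p))%:R * F p =
  \sum_a F (j, a) + \sum_(i < m.+1) (i == j.+1 :> nat)%:R * (\sum_a F (i, a))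
  + ((j, b) == (ord_max, ord0))%:R * F (ord0, ord0).
Proof.
rewrite (eq_bigr (fun p => (p.1 == j)%:R * F (p.1, p.2)
    + (p.1 == j.+1 :> nat)%:R * F (p.1, p.2)
    + (p == (ord0, ord0))%:R * (((j, b) == (ord_max, ord0))%:R * F p))); last first.
  case=> i a _; rewrite layer_adj_sym layer_adjE /= !mulrDl.
  rewrite /layer_end xpair_eqE -mulnb natrM -mulrA; by congr (_ + _ * (_ * _)).
rewrite !big_split /= sum_delta; congr (_ + _ + _).
  rewrite -(pair_bigA _ (fun i a => (i == j)%:R * F (i, a))) /=.
  by under eq_bigr do rewrite -mulr_sumr; rewrite sum_delta.
rewrite -(pair_bigA _ (fun (i : 'I_m.+1) a => (i == j.+1 :> nat)%:R * F (i, a))) /=.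
by apply: eq_bigr => i _; rewrite -mulr_sumr.
Qed.

Lemma sum_pred_ord (i : 'I_m.+1) :
  \sum_(j < m.+1) (i == j.+1 :> nat)%:R = (i != ord0)%:R :> rat.
Proof.
case: i => -[|i] im; first by rewrite big1.
rewrite (bigD1 (Ordinal (ltnW im))) //= eqxx big1 ?addr0 // => j.
by rewrite -val_eqE /= eqSS eq_sym => /negPf ->.
Qed.

Lemma sum_succ_ord (j : 'I_m.+1) :
  \sum_(i < m.+1) (i == j.+1 :> nat)%:R = (j != ord_max)%:R :> rat.
Proof.
case: (j =P ord_max) => [->|/eqP jm] /=.
  by rewrite big1 // => i _; rewrite ltn_eqF.
have lt_jm : (j.+1 < m.+1)%N.
  by rewrite ltnS ltn_neqAle -ltnS ltn_ord andbT.
rewrite (bigD1 (Ordinal lt_jm)) //= eqxx big1 ?addr0 // => i.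
by rewrite -val_eqE /= => /negPf ->.
Qed.

(** The layer numbers contribute [2 * m + 1]; the corrections at the two ends contribute [n] and
    [k]. *)
Definition layer_drop : nat := n + k + 2 * m + 1.

Lemma layer_pot_drop :
  layer_pot layer_end.1 - layer_pot layer_end.2 = layer_drop%:R.
Proof. by rewrite /layer_drop /= !eqxx /=; ring. Qed.

(** In an inner layer the means of the two neighbouring layers lie symmetrically about the value. In
    an outer layer the value is the mean of the one neighbouring layer, except at the ends of the
    extra edge: there it is off by [n.+1] over [k.+1] edges, or by [k.+1] over [n.+1] edges, and
    [layer_drop] is added across the extra edge. *)
Lemma lap_layer_pot u : lap layer_pot u =
  (layer_drop + n.+1 * k.+1)%:R
  * ((u == layer_end.1)%:R - (u == layer_end.2)%:R).
Proof.
rewrite /lap big_sumType /=; case: u => -[i a].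
  rewrite big1 ?add0r => [|z _]; last exact: mul0r.
  rewrite (sum_layer_adj_l _ _ (fun r => _ - layer_pot (inr r))) sum_layer_pot_r.
  set c := layer_pot _.
  rewrite (eq_bigr (fun j : 'I_m.+1 => (i == j.+1 :> nat)%:R
      * (k.+1%:R * (c + 2 * i%:R - 1)))) => [|j _]; last first.
    case: (i =P j.+1 :> nat) => [e|_] /=; last by rewrite !mul0r.
    by rewrite sum_layer_pot_r e; ring.
  rewrite -mulr_suml sum_pred_ord subr0.
  rewrite /c; case: ((i, a) =P _) => [[-> ->]|ia].
    by rewrite layer_pot_drop ?eqxx /=; ring.
  have -> : (inl (i, a) == layer_end.1) = false 
    by apply/eqP => -[ei ea]; case: ia; rewrite ei ea.
  rewrite /=; case: (eqVneq i ord0) => [i0|_] /=; last by ring.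
  have /negPf -> : a != ord0 by apply/eqP => a0; case: ia; rewrite i0 a0.
  by rewrite i0 ?eqxx /=; ring.
rewrite addrC big1 ?add0r => [|z _]; last exact: mul0r.
rewrite (sum_layer_adj_r _ _ (fun p => _ - layer_pot (inl p))) sum_layer_pot_l.
set c := layer_pot _.
rewrite (eq_bigr (fun i' : 'I_m.+1 => (i' == i.+1 :> nat)%:R
    * (n.+1%:R * (c + 2 * i%:R + 2)))) => [|j _]; last first.
  case: (j =P i.+1 :> nat) => [e|_] /=; last by rewrite !mul0r.
  by rewrite sum_layer_pot_l e; ring.
rewrite -mulr_suml sum_succ_ord.
rewrite /c; case: ((i, a) =P _) => [[-> ->]|ia].
  by rewrite /layer_drop /= !eqxx /=; ring.
have -> : (inr (i, a) == layer_end.2) = false 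
  by apply/eqP => -[ei ea]; case: ia; rewrite ei ea.
rewrite /=; case: (eqVneq i ord_max) => [im|_] /=; last by ring.
have /negPf -> : a != ord0 by apply/eqP => a0; case: ia; rewrite im a0.
by rewrite im ?eqxx /=; ring.
Qed.

(** * Densities in the layered graph *)

Lemma layered_density_end :
  density [set (layer_end.1 : layered); layer_end.2] =
  layer_drop%:R / (layer_drop + n.+1 * k.+1)%:R.
Proof.
have xy : @adj layered layer_end.1 layer_end.2 by rewrite /= eqxx orbT.
have := tau_edge_potential xy lap_layer_pot; rewrite layer_pot_drop => e.
have t0 : (tau layered)%:R != 0 :> rat.
  by rewrite pnatr_eq0 -lt0n tau_gt0 //; apply: layered_connected.
have C0 : (layer_drop + n.+1 * k.+1)%:R != 0 :> rat.
  by rewrite pnatr_eq0 addn_eq0 muln_eq0 andbF.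
by apply/eqP; rewrite /density eqr_div // mulrC -e mulrC.
Qed.

(** The layers [A] and [B] of the two ends span a biclique, to which [tau_edge_biclique] applies
    inside the whole graph. *)
Lemma layered_density_link (u v : layered) : adj u v ->
  (u, v) != layer_end -> (v, u) != layer_end ->
  density [set u; v] <= (6 * (n.+1 + k.+1 + 1))%:R / (n.+1 * k.+1)%:R.
Proof.
have link (p : 'I_m.+1 * 'I_n.+1) (s : 'I_m.+1 * 'I_k.+1) : layer_link p.1 s.1 ->
    density [set (inl p : layered); inr s]
      <= (6 * (n.+1 + k.+1 + 1))%:R / (n.+1 * k.+1)%:R.
  move=> ps.
  pose A : {set layered} := [set inl (p.1, a) | a : 'I_n.+1].
  pose B : {set layered} := [set inr (s.1, b) | b : 'I_k.+1].
  have cA : #|A| = n.+1 by rewrite card_imset ?card_ord // => ? ? [].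
  have cB : #|B| = k.+1 by rewrite card_imset ?card_ord // => ? ? [].
  have pA : inl p \in A by apply/imsetP; exists p.2; case: p {ps A cA}.
  have sB : inr s \in B by apply/imsetP; exists s.2; case: s {ps B cB}.
  have := tau_edge_biclique pA sB; rewrite cA cB => bound.
  have t0 : (0 < tau layered)%N by apply/tau_gt0/layered_connected.
  rewrite /density ler_pdivrMr ?ltr0n // mulrAC ler_pdivlMr ?ltr0n ?muln_gt0 //.
  rewrite -!natrM ler_nat mulnC; apply: bound => _ _ /imsetP[a _ ->] /imsetP[b _ ->].
  by rewrite /= ps.
case: u v => [p|s] [s'|p'] //=.
  by move=> /orP[/link//|/eqP ->]; rewrite eqxx.
by move=> /orP[/link|/eqP ->]; rewrite ?eqxx // setUC.
Qed.

Lemma layered_dep :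
  (6 * (n.+1 + k.+1 + 1))%:R / (n.+1 * k.+1)%:R
    <= layer_drop%:R / (layer_drop + n.+1 * k.+1)%:R :> rat ->
  dep layered = layer_drop%:R / (layer_drop + n.+1 * k.+1)%:R.
Proof.
move=> le_bound; rewrite -layered_density_end in le_bound *.
have eE : [set (layer_end.1 : layered); layer_end.2] \in edges layered.
  by rewrite mem_edges /= eqxx orbT.
apply/eqP; rewrite eq_le [X in _ && X]le_bigmax_cond // andbT.
apply/bigmax_leP; split=> [|f].
  by rewrite divr_ge0 ?ler0n.
rewrite inE => /existsP[u /existsP[v /andP[uv /eqP ->]]].
have [[eu ev]|/eqP uve] := ((u, v) =P layer_end); first by rewrite eu ev.
have [[ev eu]|/eqP vue] := ((v, u) =P layer_end).
  by rewrite eu ev setUC.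
exact: le_trans (layered_density_link uv uve vue) le_bound.
Qed.

End LayeredGraph.

(** * Choice of the layer sizes and of the number of layers *)

Theorem corollary2p9 (p q : nat) (hp : (0 < p)%N) (hq : (0 < q)%N)
    (hpq : (p < q)%N) :
  exists G : sgraph, [/\ connected G, bipartite G & dep G = p%:R / q%:R].
Proof.
pose r := (q - p)%N; pose t := (18 * q)%N.
have r_gt0 : (0 < r)%N by rewrite subn_gt0.
have qE : q = (p + r)%N by rewrite subnKC // ltnW.
(* The factor [r] in [n.+1] makes [layer_drop] an integer when solving for it. Since [n.+1] and [k]
   are even, what remains for [2 * m] is even too. *)
pose n := (2 * t * r).-1; pose k := (2 * t)%N.
(* [m] solves [r * layer_drop m n k = p * (n.+1 * k.+1)]. *)
pose m := (t * (p * (2 * t).+1 - r.+1))%N.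
have nE : n.+1 = (2 * t * r)%N.
  by rewrite prednK // !muln_gt0 r_gt0 /t; lia.
(* This makes the truncated subtraction in [m] exact and [m] positive. *)
have rp : (r.+1 < p * (2 * t).+1)%N.
  by apply: (@leq_trans (1 * (2 * t).+1)); [lia | rewrite leq_mul2r hp orbT].
have m_gt0 : (0 < m)%N by rewrite muln_gt0 subn_gt0 rp /t; lia.
have DE : layer_drop m n k = (2 * t * p * (2 * t).+1)%N.
  have -> : layer_drop m n k = (n.+1 + k + 2 * m)%N by rewrite /layer_drop; lia.
  have mE : (m + t * r.+1 = t * (p * (2 * t).+1))%N.
    by rewrite -mulnDr subnK // ltnW.
  by rewrite nE /k; nia.
have CE : (layer_drop m n k + n.+1 * k.+1)%N = (2 * t * (2 * t).+1 * q)%N.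
  by rewrite DE nE /k [in RHS]qE; nia.
have ratE : (layer_drop m n k)%:R / (layer_drop m n k + n.+1 * k.+1)%:R
    = p%:R / q%:R :> rat.
  have q0 : q%:R != 0 :> rat by rewrite pnatr_eq0 -lt0n.
  have C0 : (2 * t * (2 * t).+1 * q)%:R != 0 :> rat.
    by rewrite pnatr_eq0 !muln_eq0 /t; lia.
  rewrite CE DE; apply/eqP; rewrite eqr_div // -!natrM; apply/eqP.
  by congr _%:R; ring.
exists (layered m n k); split.
- exact: layered_connected.
- exact: layered_bipartite.
- have := @layered_dep m n k m_gt0; rewrite ratE; apply.
  rewrite ler_pdivlMr ?ltr0n // mulrAC ler_pdivrMr ?ltr0n ?muln_gt0 //.
  rewrite -!natrM ler_nat nE /k.
  (* The leading terms are now [216 * q ^ 2 * (r + 1)] on the left and [1296 * p * r * q ^ 2] on the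
     right. *)
  have t36 : (2 * t = 36 * q)%N by rewrite /t; lia.
  rewrite t36; move: r_gt0 hp hq; clear; nia.
Qed.
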